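(* Let $\bm{\gamma}: I \to \mathbb{R}^3$ be a curve admitting a generalized Frenet frame, let $k \in \mathbb{Z}$, and let $\{\bm{t}_k, \bm{d}_k, \bm{t}_{k+1}\}$ be a $k$th-order Frenet frame along $\bm{\gamma}$ with $k$th-order curvature $\kappa_k$ and $k$th-order torsion $\tau_k$. Assume that $(\kappa_k(t), \tau_k(t)) \neq (0,0)$ for all $t \in I$. Define $$\bm{d}_{k+1}(t) = \frac{-\tau_k(t)\,\bm{t}_k(t) + \kappa_k(t)\,\bm{d}_k(t)}{\sqrt{\kappa_k^2(t) + \tau_k^2(t)}}, \qquad t \in I.$$ Then $(\bm{t}_{k+1}, \bm{d}_{k+1}): I \to \Delta$ is a Legendre curve. Moreover, setting $\bm{t}_{k+2}(t) = \bm{t}_{k+1}(t) \times \bm{d}_{k+1}(t)$, the $(k+1)$st-order curvature $\kappa_{k+1}(t) = \langle \dot{\bm{t}}_{k+1}(t), \bm{t}_{k+2}(t)\rangle$ and torsion $\tau_{k+1}(t) = \langle \dot{\bm{d}}_{k+1}(t), \bm{t}_{k+2}(t)\rangle$ are, for all $t \in I$, $$\kappa_{k+1}(t) = \sqrt{\kappa_k^2(t) + \tau_k^2(t)}, \qquad \tau_{k+1}(t) = \frac{\kappa_k(t)\dot{\tau}_k(t) - \dot{\kappa}_k(t)\tau_k(t)}{\kappa_k^2(t) + \tau_k^2(t)}.$$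
   Context: All curves and maps are of class $C^\infty$; $I \subset \mathbb{R}$ is an interval; a dot denotes $d/dt$; $\langle\cdot,\cdot\rangle$ and $\times$ are the standard inner product and cross product on $\mathbb{R}^3$; $S^2$ is the unit sphere. Let $\Delta = \{(\bm{a},\bm{b}) \in S^2 \times S^2 \mid \langle \bm{a},\bm{b}\rangle = 0\}$. Legendre curve: a map $(\bm{\sigma},\bm{\nu}): I \to \Delta$ with $\langle \dot{\bm{\sigma}}(t), \bm{\nu}(t)\rangle = 0$ for all $t \in I$. A curve $\bm{\sigma}: I \to S^2$ is a frontal if there is $\bm{\nu}: I \to S^2$ such that $(\bm{\sigma},\bm{\nu})$ is a Legendre curve; then $\bm{\nu}$ is called a dual of $\bm{\sigma}$. Generalized Frenet frame: $\bm{\gamma}: I \to \mathbb{R}^3$ admits a generalized Frenet frame if there exist $\alpha: I \to \mathbb{R}$ and $\bm{t}: I \to S^2$ with $\dot{\bm{\gamma}}(t) = \alpha(t)\bm{t}(t)$ for all $t\in I$ and $\bm{t}$ is a frontal in $S^2$. $k$th-order Frenet frames $\{\bm{t}_k,\bm{d}_k,\bm{t}_{k+1}\}$ along $\bm{\gamma}$ are defined as follows. Order $0$: $\bm{t}_0 = \bm{t}$, where $\bm{t}: I \to S^2$ is a frontal in $S^2$ satisfying $\dot{\bm{\gamma}}(t) = \alpha(t)\bm{t}(t)$ for all $t \in I$ with some $\alpha: I \to \mathbb{R}$, $\bm{d}_0$ is a dual of $\bm{t}_0$, and $\bm{t}_1 = \bm{t}_0 \times \bm{d}_0$. Increasing order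 ($k \geq 1$): given the frame of order $k-1$, whenever $\bm{t}_k$ is a frontal in $S^2$, choose a dual $\bm{d}_k$ of $\bm{t}_k$ and set $\bm{t}_{k+1} = \bm{t}_k \times \bm{d}_k$. Decreasing order: given the frame $\{\bm{t}_k,\bm{d}_k,\bm{t}_{k+1}\}$ of order $k \leq 0$, choose $\theta: I \to \mathbb{R}$ with $\dot\theta(t) = \langle \dot{\bm{d}}_k(t), \bm{t}_{k+1}(t)\rangle$ and set $\bm{t}_{k-1} = \cos\theta\,\bm{d}_k - \sin\theta\,\bm{t}_{k+1}$, $\bm{d}_{k-1} = \sin\theta\,\bm{d}_k + \cos\theta\,\bm{t}_{k+1}$; then $\{\bm{t}_{k-1},\bm{d}_{k-1},\bm{t}_k\}$ is a frame of order $k-1$ (a Bishop frame: the derivatives of $\bm{t}_{k-1}$ and $\bm{d}_{k-1}$ are parallel to $\bm{t}_k$). The $k$th-order curvature and torsion are $\kappa_k(t) = \langle \dot{\bm{t}}_k(t), \bm{t}_{k+1}(t)\rangle$ and $\tau_k(t) = \langle \dot{\bm{d}}_k(t), \bm{t}_{k+1}(t)\rangle$. *)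

(* Defs.v *)
From mathcomp Require Import all_boot all_order all_algebra.
From mathcomp Require Import all_classical all_reals all_analysis.

Set Implicit Arguments.
Unset Strict Implicit.
Unset Printing Implicit Defensive.

Import Order.TTheory GRing.Theory Num.Theory.
Import numFieldNormedType.Exports.

Local Open Scope classical_set_scope.
Local Open Scope ring_scope.

(* A map defined on an interval I is represented by a total function on R; only
   its values on I matter. In particular the derivative is the limit of the
   difference quotient taken inside I, hence one-sided at an endpoint of I.
   The interval must not be a single point: otherwise this limit would run
   along the trivial filter. *)
Definition nontrivial_interval (R : realType) (I : set R) : Prop :=
  is_interval I /\ exists a b : R, [/\ I a, I b & a < b].

Section WithinDerivative.
Context {R : realType} {V : normedModType R}.
Implicit Types (I : set R) (f : R -> V).

Definition diff_quotient f (x y : R) : V := (y - x)^-1 *: (f y - f x).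

Definition derivable_within I f (x : R) : Prop :=
  cvg (diff_quotient f x y @[y --> within I x^']).

Definition derive_within I f (x : R) : V :=
  lim (diff_quotient f x y @[y --> within I x^']).

Definition smooth I f : Prop :=
  forall (n : nat) (x : R), I x ->
    derivable_within I (iter n (derive_within I) f) x.

End WithinDerivative.

Section Space.
Context {R : realType}.
Implicit Types (u v : 'rV[R]_3).

Definition dotmul u v : R := \sum_i u 0 i * v 0 i.

Definition crossmul u v : 'rV[R]_3 :=
  let c (w : 'rV[R]_3) (i : nat) : R := w 0 (inord i) in
  \row_(i < 3) [:: c u 1%N * c v 2%N - c u 2%N * c v 1%N;
                   c u 2%N * c v 0%N - c u 0%N * c v 2%N;
                   c u 0%N * c v 1%N - c u 1%N * c v 0%N]`_i.

Definition sphere2 : set 'rV[R]_3 := [set u | dotmul u u = 1].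

Definition Delta : set ('rV[R]_3 * 'rV[R]_3) :=
  [set p | [/\ sphere2 p.1, sphere2 p.2 & dotmul p.1 p.2 = 0]].

End Space.

Section Frames.
Context {R : realType}.
Implicit Types (I : set R) (gamma sigma nu t d : R -> 'rV[R]_3).

Definition legendre_curve I sigma nu : Prop :=
  [/\ smooth I sigma, smooth I nu,
      forall s, I s -> Delta (sigma s, nu s) &
      forall s, I s -> dotmul (derive_within I sigma s) (nu s) = 0].

(* nu is a dual of sigma iff legendre_curve I sigma nu *)
Definition frontal I sigma : Prop := exists nu, legendre_curve I sigma nu.

Definition tangent_direction I gamma t : Prop :=
  exists alpha : R -> R, smooth I alpha /\
    forall s, I s -> derive_within I gamma s = alpha s *: t s.

Definition admits_generalized_frenet_frame I gamma : Prop :=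
  exists t, frontal I t /\ tangent_direction I gamma t.

(* frenet_frame I gamma k t d t' : {t, d, t'} is a k-th order Frenet frame
   {t_k, d_k, t_(k+1)} along gamma. Since duals and angles are chosen, there are
   in general many frames of a given order. *)
Inductive frenet_frame I gamma :
    int -> (R -> 'rV[R]_3) -> (R -> 'rV[R]_3) -> (R -> 'rV[R]_3) -> Prop :=
| frenet_frame_zero t0 d0 t1 :
    tangent_direction I gamma t0 ->
    legendre_curve I t0 d0 ->
    (forall s, I s -> t1 s = crossmul (t0 s) (d0 s)) ->
    frenet_frame I gamma 0 t0 d0 t1
| frenet_frame_succ (k : int) t d t1 d1 t2 :
    0 <= k ->
    frenet_frame I gamma k t d t1 ->
    legendre_curve I t1 d1 ->
    (forall s, I s -> t2 s = crossmul (t1 s) (d1 s)) ->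
    frenet_frame I gamma (k + 1) t1 d1 t2
| frenet_frame_pred (k : int) t d t1 (theta : R -> R) (tm dm : R -> 'rV[R]_3) :
    k <= 0 ->
    frenet_frame I gamma k t d t1 ->
    smooth I theta ->
    (forall s, I s ->
       derive_within I theta s = dotmul (derive_within I d s) (t1 s)) ->
    (forall s, I s -> tm s = cos (theta s) *: d s - sin (theta s) *: t1 s) ->
    (forall s, I s -> dm s = sin (theta s) *: d s + cos (theta s) *: t1 s) ->
    frenet_frame I gamma (k - 1) tm dm t.

(* Curvature and torsion of a frame {t, d, t'}, which determine kappa_k and
   tau_k when the frame has order k. *)
Definition curvature I t (t' : R -> 'rV[R]_3) (s : R) : R :=
  dotmul (derive_within I t s) (t' s).

Definition torsion I d (t' : R -> 'rV[R]_3) (s : R) : R :=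
  dotmul (derive_within I d s) (t' s).

End Frames.

(* Main.v *)
Require Import Defs.
From mathcomp Require Import all_boot all_order all_algebra.
From mathcomp Require Import all_classical all_reals all_analysis.
From mathcomp Require Import ring.

(** A frame {t, d, e} of any order has two properties: (t, d) is a Legendre
    curve and e = t x d. For order 0 and for increasing orders this is the
    definition; for decreasing orders it holds because the equation satisfied
    by the angle cancels the component along the new d of the derivative of the
    new t ([moving_frame_pred], [frenet_frame_moving]). The rest is a
    computation with such a frame.

    The frame is orthonormal and t' is orthogonal to d. Differentiating the
    constant inner products gives, with curvature kappa and torsion tau,
      t' = kappa e,   d' = tau e,   e' = - kappa t - tau d.
    The vector d1 is a unit vector of span(t, d) orthogonal to e', so (e, d1)
    is a Legendre curve. Moreover
      e x d1 = - (kappa t + tau d) / sqrt (kappa^2 + tau^2)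
    is the unit vector in the direction of e', so the new curvature is the norm
    of e'. In the derivative of d1 the terms in t' and d' are multiples of e,
    hence orthogonal to e x d1: only the derivatives of the coefficients
    contribute to the new torsion, which is the rate of rotation of the plane
    vector (kappa, tau) ([dotmul_normalized_derivative]).

    The analytic part shows that d1 is smooth, derivatives being limits of
    difference quotients taken inside an interval I, so possibly one-sided.
    Smoothness is proved by induction on the number of derivatives
    ([derivable_upto]): a function is n+1 times derivable as soon as its
    derivative is n times derivable, and the usual rules express the derivative
    of a product, of a cosine or of an inverse square root by functions for
    which the induction hypothesis is available. *)

Set Implicit Arguments.
Unset Strict Implicit.
Unset Printing Implicit Defensive.

Import Order.TTheory GRing.Theory Num.Theory.
Import numFieldNormedType.Exports.

Local Open Scope classical_set_scope.
Local Open Scope ring_scope.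

(** * Vector algebra in dimension three *)

Section VectorAlgebra.
Context {R : realType}.
Implicit Types (u v w : 'rV[R]_3) (a : R).

(** The index is a natural number, so that [coord3 0], [coord3 1] and [coord3 2]
    are literal atoms for [ring]. *)
Definition coord3 (k : nat) u : R := u 0 (inord k).

Lemma dotmulE u v :
  dotmul u v = coord3 0 u * coord3 0 v + coord3 1 u * coord3 1 v
             + coord3 2 u * coord3 2 v.
Proof.
rewrite /dotmul !big_ord_recl big_ord0 addr0 addrA /coord3.
by congr (_ + _ + _); congr (u 0 _ * v 0 _); apply/val_inj; rewrite /= inordK.
Qed.

Lemma crossmulE u v :
  let x := coord3 in
  (x 0 (crossmul u v) = x 1 u * x 2 v - x 2 u * x 1 v) *
  (x 1 (crossmul u v) = x 2 u * x 0 v - x 0 u * x 2 v) *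
  (x 2 (crossmul u v) = x 0 u * x 1 v - x 1 u * x 0 v).
Proof. by rewrite /coord3 !mxE !inordK. Qed.

Lemma coord3D k u v : coord3 k (u + v) = coord3 k u + coord3 k v.
Proof. by rewrite /coord3 mxE. Qed.

Lemma coord3N k u : coord3 k (- u) = - coord3 k u.
Proof. by rewrite /coord3 mxE. Qed.

Lemma coord3Z k a u : coord3 k (a *: u) = a * coord3 k u.
Proof. by rewrite /coord3 mxE. Qed.

Definition coord3E := (coord3D, coord3N, coord3Z, crossmulE, dotmulE).

Lemma eq_rV3 u v :
  coord3 0 u = coord3 0 v -> coord3 1 u = coord3 1 v ->
  coord3 2 u = coord3 2 v -> u = v.
Proof.
have uvk (i : 'I_3) k :
    i = k :> nat -> coord3 k u = coord3 k v -> u 0 i = v 0 i.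
  by rewrite /coord3 => <-; rewrite inord_val.
move=> u0 u1 u2; apply/rowP => i.
case: i => -[|[|[|//]]] lti.
- exact: (uvk (Ordinal lti) 0%N).
- exact: (uvk (Ordinal lti) 1%N).
- exact: (uvk (Ordinal lti) 2%N).
Qed.

Lemma dotmulC u v : dotmul u v = dotmul v u.
Proof. by rewrite !dotmulE; ring. Qed.

Lemma dotmulDl u v w : dotmul (u + v) w = dotmul u w + dotmul v w.
Proof. by rewrite !coord3E; ring. Qed.

Lemma dotmulZl a u v : dotmul (a *: u) v = a * dotmul u v.
Proof. by rewrite !coord3E; ring. Qed.

Lemma dotmulDr u v w : dotmul u (v + w) = dotmul u v + dotmul u w.
Proof. by rewrite !(dotmulC u) dotmulDl. Qed.

Lemma dotmulZr a u v : dotmul u (a *: v) = a * dotmul u v.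
Proof. by rewrite !(dotmulC u) dotmulZl. Qed.

Lemma dotmul_crossl u v : dotmul (crossmul u v) u = 0.
Proof. by rewrite dotmulE !crossmulE; ring. Qed.

Lemma dotmul_crossr u v : dotmul (crossmul u v) v = 0.
Proof. by rewrite dotmulE !crossmulE; ring. Qed.

Lemma lagrange_identity u v : dotmul (crossmul u v) (crossmul u v) =
  dotmul u u * dotmul v v - dotmul u v ^+ 2.
Proof. by rewrite !dotmulE !crossmulE; ring. Qed.

Lemma crossmulC u v : crossmul u v = - crossmul v u.
Proof. by apply: eq_rV3; rewrite !coord3E; ring. Qed.

Lemma crossmulDr u v w : crossmul u (v + w) = crossmul u v + crossmul u w.
Proof. by apply: eq_rV3; rewrite !coord3E; ring. Qed.

Lemma crossmulZr a u v : crossmul u (a *: v) = a *: crossmul u v.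
Proof. by apply: eq_rV3; rewrite !coord3E; ring. Qed.

(** The matrix with rows (a, - b) and (b, a) has determinant a^2 + b^2. For a
    cosine and a sine, a rotation of the pair (u, v) keeps the normal. *)
Lemma crossmul_rotate a b u v :
  crossmul (a *: u - b *: v) (b *: u + a *: v) =
  (a ^+ 2 + b ^+ 2) *: crossmul u v.
Proof. by apply: eq_rV3; rewrite !coord3E; ring. Qed.

Lemma triple_product u v w :
  crossmul (crossmul u v) w = dotmul u w *: v - dotmul v w *: u.
Proof. by apply: eq_rV3; rewrite !coord3E; ring. Qed.

Lemma crossmul_frame u v (w := crossmul u v) : Delta (u, v) ->
  [/\ crossmul w u = v, crossmul w v = - u & crossmul v w = u].
Proof.
move=> [/= uu vv uv]; rewrite [crossmul v w]crossmulC !triple_product.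
rewrite (dotmulC v u) [dotmul u u]uu [dotmul v v]vv uv.
by rewrite !scale0r !scale1r subr0 sub0r opprK.
Qed.

Lemma dotmul_frame u v (w := crossmul u v) : Delta (u, v) ->
  [/\ dotmul w u = 0, dotmul w v = 0 & dotmul w w = 1].
Proof.
move=> [/= uu vv uv]; rewrite dotmul_crossl dotmul_crossr lagrange_identity.
by rewrite [dotmul u u]uu [dotmul v v]vv uv mulr1 expr0n subr0.
Qed.

(** The first factor is the derivative of q (- b u + a v) by the Leibniz rule,
    u' and v' being the derivatives of u and v. The terms in q', u' and v' are
    orthogonal to a u + b v, which leaves the determinant of (a, b) and its
    derivative. *)
Lemma dotmul_normalized_derivative u v u' v' (q q' a a' b b' : R) :
  Delta (u, v) -> dotmul u' u = 0 -> dotmul u' v = 0 ->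
  dotmul v' u = 0 -> dotmul v' v = 0 ->
  dotmul (q' *: (- b *: u + a *: v) +
          q *: (- b' *: u + - b *: u' + (a' *: v + a *: v')))
         (- q *: (a *: u + b *: v)) = q ^+ 2 * (a * b' - a' * b).
Proof.
move=> [/= uu vv uv] u'u u'v v'u v'v.
rewrite !(dotmulZr, dotmulZl, dotmulDl, dotmulDr) (dotmulC v u).
by rewrite [dotmul u u]uu [dotmul v v]vv uv u'u u'v v'u v'v; ring.
Qed.

End VectorAlgebra.

(** * Derivatives within an interval *)

Section CalculusOnInterval.
Context {R : realType} (I : set R) (I_nontrivial : nontrivial_interval I).
Implicit Types (V : normedModType R) (x : R).

Definition has_derivative_within {V} (f : R -> V) x (l : V) : Prop :=
  diff_quotient f x y @[y --> within I x^'] --> l.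

(** A point of I can be approached inside I by moving towards another point c of
    I: this is where I having two points matters, and it makes limits of
    difference quotients unique. *)
Lemma within_dnbhs_proper x : I x -> ProperFilter (within I x^').
Proof.
move=> Ix; apply: Build_ProperFilter => -[e /= e0 xeP].
have [I_itv [a [b [Ia Ib ab]]]] := I_nontrivial.
have [c Ic cx] : exists2 c, I c & c != x.
  have [ax|ax] := eqVneq a x; last by exists a.
  by exists b => //; rewrite -ax gt_eqF.
have cx0 : 0 < `|c - x| by rewrite normr_gt0 subr_eq0.
(* At most 1 to stay in I, and small enough to come within e of x. *)
pose r := Num.min 1 (e / 2 / `|c - x|).
have r0 : 0 < r by rewrite lt_min ltr01 !divr_gt0.
have r1 : r <= 1 by rewrite ge_min lexx.
have re : r * `|c - x| < e.
  rewrite (@le_lt_trans _ _ (e / 2)) ?ltr_pdivrMr ?ltr_pMr ?ltr1n //.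
  by rewrite -ler_pdivlMr // ge_min lexx orbT.
pose y := x + r * (c - x).
have yx : y - x = r * (c - x) by rewrite /y addrAC subrr add0r.
apply: (xeP y).
- by rewrite /= distrC yx normrM (gtr0_norm r0).
- by rewrite /= -subr_eq0 yx mulf_neq0 ?(gt_eqF r0) ?subr_eq0.
have yc : c - y = (1 - r) * (c - x) by rewrite /y; ring.
have [cx'|xc] := ltP c x.
  apply: (I_itv c x Ic Ix).
  by rewrite -subr_le0 yc -[y <= x]subr_le0 yx !mulr_ge0_le0 ?subr_ge0 ?subr_le0
    ?(ltW r0) ?(ltW cx').
apply: (I_itv x c Ix Ic).
by rewrite -[_ <= c]subr_ge0 yc -subr_ge0 yx !mulr_ge0 ?subr_ge0 ?(ltW r0).
Qed.

Lemma has_derivative_within_unique {V} (f : R -> V) x l :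
  I x -> has_derivative_within f x l -> derive_within I f x = l.
Proof.
move=> Ix fl; have := within_dnbhs_proper Ix => ?.
exact: (cvg_lim (@norm_hausdorff _ _) fl).
Qed.

Lemma derivable_withinP {V} (f : R -> V) x :
  derivable_within I f x -> has_derivative_within f x (derive_within I f x).
Proof. by []. Qed.

Lemma has_derivative_within_ext {V} (f g : R -> V) x l :
  I x -> (forall y, I y -> f y = g y) ->
  has_derivative_within f x l -> has_derivative_within g x l.
Proof.
move=> Ix fg; apply: cvg_trans; apply: near_eq_cvg.
near=> y; rewrite /diff_quotient !fg //.
by near: y; exact: near_withinT.
Unshelve. all: by end_near. Qed.

Lemma derive_within_ext {V} (f g : R -> V) x :
  I x -> (forall y, I y -> f y = g y) ->
  derive_within I f x = derive_within I g x.
Proof.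
move=> Ix fg; rewrite /derive_within.
have h (f' g' : R -> V) : (forall y, I y -> f' y = g' y) ->
  diff_quotient f' x y @[y --> within I x^'] `=>`
  diff_quotient g' x y @[y --> within I x^'].
  move=> fg'; apply: near_eq_cvg; near=> y; rewrite /diff_quotient !fg' //.
  by near: y; exact: near_withinT.
congr (lim _); apply/seteqP; split; first by apply: h => y /fg.
exact: h.
Unshelve. all: by end_near. Qed.

(** f y = f x + (y - x) q(y), where the difference quotient q(y) has a limit. *)
Lemma has_derivative_within_continuous {V} (f : R -> V) x l :
  has_derivative_within f x l -> f y @[y --> within I x^'] --> f x.
Proof.
move=> fl.
have yx : (y - x) @[y --> within I x^'] --> (0 : R).
  have : (y - x) @[y --> x] --> x - x.
    by apply: cvgB; [exact: cvg_id | exact: cvg_cst].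
  rewrite subrr => yx; apply: cvg_within_filter.
  exact: (cvg_within_filter (F := nbhs x) _ yx).
have : f x + (y - x) *: diff_quotient f x y @[y --> within I x^'] -->
    f x + 0 *: l.
  by apply: cvgD; [exact: cvg_cst | exact: cvgZ].
rewrite scale0r addr0; apply: cvg_trans; apply: near_eq_cvg.
have Nx : \forall y \near within I x^', y != x.
  exact: filterS (nbhs_dnbhs_neq x).
near=> y; have yNx : y - x != 0.
  by rewrite subr_eq0; near: y; exact: Nx.
by rewrite /diff_quotient scalerA divff // scale1r addrC subrK.
Unshelve. all: by end_near. Qed.

Lemma has_derivative_within_cst {V} (v : V) x :
  has_derivative_within (fun=> v) x 0.
Proof.
rewrite /has_derivative_within /diff_quotient subrr.
under eq_fun do rewrite scaler0.
exact: cvg_cst.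
Qed.

Lemma has_derivative_withinD {V} (f g : R -> V) x l m :
  has_derivative_within f x l -> has_derivative_within g x m ->
  has_derivative_within (fun y => f y + g y) x (l + m).
Proof.
move=> fl gm; rewrite /has_derivative_within.
rewrite (_ : diff_quotient _ x = diff_quotient f x + diff_quotient g x).
  exact: cvgD.
by apply/funext => y; rewrite fctE /diff_quotient -scalerDr opprD addrACA.
Qed.

Lemma has_derivative_withinZ {V} (a : R -> R) (f : R -> V) x b l :
  has_derivative_within a x b -> has_derivative_within f x l ->
  has_derivative_within (fun y => a y *: f y) x (b *: f x + a x *: l).
Proof.
move=> ab fl; rewrite /has_derivative_within.
rewrite (_ : diff_quotient _ x =
  (fun y => diff_quotient a x y *: f x) +
  (fun y => a y *: diff_quotient f x y)).
  apply: cvgD; first exact: cvgZr_tmp ab.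
  exact: cvgZ (has_derivative_within_continuous ab) fl.
apply/funext => y; rewrite fctE.
rewrite [diff_quotient a x y]/((y - x)^-1 * (a y - a x)) /diff_quotient.
rewrite [a y *: (_ *: _)]scalerA [a y * _]mulrC -!scalerA -scalerDr scalerBl.
by congr (_ *: _); rewrite scalerBr [RHS]addrC [RHS]addrA subrK.
Qed.

Lemma has_derivative_withinN {V} (f : R -> V) x l :
  has_derivative_within f x l -> has_derivative_within (fun y => - f y) x (- l).
Proof.
move=> fl; rewrite /has_derivative_within.
rewrite (_ : diff_quotient _ x = - diff_quotient f x); first exact: cvgN.
by apply/funext => y; rewrite fctE /diff_quotient -opprD scalerN.
Qed.

(** Caratheodory's form of differentiability, phi z - phi (f x) = g z (z - f x)
    with g continuous at f x, needs no division by f y - f x, which may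
    vanish. *)
Lemma has_derivative_within_comp (phi f : R -> R) x l m :
  is_derive (f x) 1 phi m -> has_derivative_within f x l ->
  has_derivative_within (fun y => phi (f y)) x (m * l).
Proof.
move=> /is_derive1_caratheodory[g [gE gc <-]] fl.
rewrite /has_derivative_within.
rewrite (_ : diff_quotient _ x = (fun y => g (f y)) * diff_quotient f x).
  apply: (cvgM _ fl); apply: (continuous_cvg _ gc).
  exact: has_derivative_within_continuous fl.
apply/funext => y; rewrite fctE /diff_quotient gE.
by rewrite -[LHS]/((y - x)^-1 * (g (f y) * (f y - f x))) mulrCA.
Qed.

Lemma has_derivative_within_coord n (u : R -> 'rV[R]_n) x (v : 'rV[R]_n) i :
  has_derivative_within u x v ->
  has_derivative_within (fun y => u y 0 i : R) x (v 0 i).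
Proof.
move=> uv; rewrite /has_derivative_within.
rewrite (_ : diff_quotient _ x =
  (fun w : 'rV[R]_n => w 0 i) \o diff_quotient u x).
  exact: continuous_cvg (@coord_continuous _ _ _ 0 i v) uv.
by apply/funext => y; rewrite /diff_quotient /= !mxE.
Qed.

(** * Smoothness within an interval *)

(** The truncation of [smooth] to n derivatives, as needed for inductions on the
    order: the derivative of a product involves the factors themselves, so the
    induction must keep them at the same order as their derivatives. *)
Definition derivable_upto {V} n (f : R -> V) : Prop :=
  forall m x, (m < n)%N -> I x ->
    derivable_within I (iter m (derive_within I) f) x.

Lemma smoothP {V} (f : R -> V) : smooth I f <-> forall n, derivable_upto n f.
Proof. by split=> [sf n m x _|sf m x]; [exact: sf | exact: (sf m.+1)]. Qed.

Lemma derivable_uptoW {V} n (f : R -> V) :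
  derivable_upto n.+1 f -> derivable_upto n f.
Proof. by move=> fn m x mn; apply: fn; exact: ltnW. Qed.

Lemma iter_derive_within_ext {V} n (f g : R -> V) :
  (forall y, I y -> f y = g y) ->
  forall y, I y -> iter n (derive_within I) f y = iter n (derive_within I) g y.
Proof. by move=> fg; elim: n => //= n IH y Iy; apply: derive_within_ext. Qed.

Lemma derivable_within_ext {V} (f g : R -> V) x :
  I x -> (forall y, I y -> f y = g y) ->
  derivable_within I f x -> derivable_within I g x.
Proof.
move=> Ix fg /derivable_withinP /(has_derivative_within_ext Ix fg) fx.
by apply/cvg_ex; exists (derive_within I f x).
Qed.

Lemma smooth_ext {V} (f g : R -> V) :
  (forall y, I y -> f y = g y) -> smooth I f -> smooth I g.
Proof.
move=> fg sf n x Ix; apply: derivable_within_ext (sf n x Ix) => //.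
exact: iter_derive_within_ext.
Qed.

Lemma derivable_upto_derive {V} n (f : R -> V) :
  derivable_upto n.+1 f ->
  (forall x, I x -> has_derivative_within f x (derive_within I f x)) /\
  derivable_upto n (derive_within I f).
Proof.
move=> fn; split=> [x Ix|m x mn Ix]; first exact/derivable_withinP/(fn 0).
by rewrite -iterSr; exact: fn.
Qed.

(** The induction step of the smoothness proofs below: it asks for an explicit
    derivative rather than for the limit [derive_within]. *)
Lemma derivable_uptoS {V} n (f f' : R -> V) :
  (forall x, I x -> has_derivative_within f x (f' x)) ->
  derivable_upto n f' -> derivable_upto n.+1 f.
Proof.
move=> ff' f'n [|m] x mn Ix; first by apply/cvg_ex; exists (f' x); exact: ff'.
rewrite iterSr; apply: derivable_within_ext (f'n m x mn Ix) => //.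
apply: iter_derive_within_ext => y Iy.
by rewrite (has_derivative_within_unique Iy (ff' y Iy)).
Qed.

Lemma smooth_derivative {V} (f : R -> V) x :
  smooth I f -> I x -> has_derivative_within f x (derive_within I f x).
Proof. by move=> sf Ix; exact/derivable_withinP/(sf 0%N). Qed.

Lemma smooth_derive {V} (f : R -> V) :
  smooth I f -> smooth I (derive_within I f).
Proof. by move=> sf n x Ix; rewrite -iterSr; exact: sf. Qed.

Lemma derivable_upto_cst {V} n (v : V) : derivable_upto n (fun=> v).
Proof.
elim: n v => // n IH v.
apply: (@derivable_uptoS _ _ _ (fun=> 0)); last exact: IH.
by move=> x _; exact: has_derivative_within_cst.
Qed.

Lemma derivable_uptoD {V} n (f g : R -> V) :
  derivable_upto n f -> derivable_upto n g ->
  derivable_upto n (fun y => f y + g y).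
Proof.
elim: n f g => // n IH f g /derivable_upto_derive[ff' f'n].
move=> /derivable_upto_derive[gg' g'n].
apply: derivable_uptoS (IH _ _ f'n g'n) => x Ix.
by apply: has_derivative_withinD; [exact: ff' | exact: gg'].
Qed.

Lemma derivable_uptoZ {V} n (a : R -> R) (f : R -> V) :
  derivable_upto n a -> derivable_upto n f ->
  derivable_upto n (fun y => a y *: f y).
Proof.
elim: n a f => // n IH a f an fn.
have [aa' a'n] := derivable_upto_derive an.
have [ff' f'n] := derivable_upto_derive fn.
apply: (@derivable_uptoS _ _ _
  (fun y => derive_within I a y *: f y + a y *: derive_within I f y)).
  by move=> x Ix; apply: has_derivative_withinZ; [exact: aa' | exact: ff'].
exact: derivable_uptoD (IH _ _ a'n (derivable_uptoW fn))
  (IH _ _ (derivable_uptoW an) f'n).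
Qed.

Lemma derivable_uptoM n (a b : R -> R) :
  derivable_upto n a -> derivable_upto n b ->
  derivable_upto n (fun y => a y * b y : R).
Proof. by move=> an bn; exact: (derivable_uptoZ an bn). Qed.

Lemma smooth_cst {V} (v : V) : smooth I (fun=> v).
Proof. by apply/smoothP => n; exact: derivable_upto_cst. Qed.

Lemma smoothD {V} (f g : R -> V) :
  smooth I f -> smooth I g -> smooth I (fun y => f y + g y).
Proof.
by move=> /smoothP sf /smoothP sg; apply/smoothP => n; exact: derivable_uptoD.
Qed.

Lemma smoothZ {V} (a : R -> R) (f : R -> V) :
  smooth I a -> smooth I f -> smooth I (fun y => a y *: f y).
Proof.
by move=> /smoothP sa /smoothP sf; apply/smoothP => n; exact: derivable_uptoZ.
Qed.

Lemma smoothM (a b : R -> R) :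
  smooth I a -> smooth I b -> smooth I (fun y => a y * b y : R).
Proof. by move=> sa sb; exact: (smoothZ sa sb). Qed.

Lemma smoothN {V} (f : R -> V) : smooth I f -> smooth I (fun y => - f y).
Proof.
move=> sf; apply: smooth_ext (smoothZ (@smooth_cst _ (-1 : R)) sf) => y _.
exact: scaleN1r.
Qed.

Lemma smoothB {V} (f g : R -> V) :
  smooth I f -> smooth I g -> smooth I (fun y => f y - g y).
Proof. by move=> sf sg; apply: smoothD => //; exact: smoothN. Qed.

Lemma smooth_sum {V} (J : Type) (r : seq J) (F : J -> R -> V) :
  (forall j, smooth I (F j)) -> smooth I (fun y => \sum_(j <- r) F j y).
Proof.
move=> sF; elim: r => [|j r IH].
  by apply: smooth_ext (@smooth_cst _ 0) => y _; rewrite big_nil.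
by apply: smooth_ext (smoothD (sF j) IH) => y _; rewrite big_cons.
Qed.

(** Cosine and sine occur in the derivative of each other, so the induction on
    the order treats them together. *)
Lemma smooth_cos_sin (theta : R -> R) : smooth I theta ->
  smooth I (fun y => cos (theta y) : R) /\
  smooth I (fun y => sin (theta y) : R).
Proof.
move=> st; suff cs n : derivable_upto n (fun y => cos (theta y) : R) /\
    derivable_upto n (fun y => sin (theta y) : R).
  by split; apply/smoothP => n; case: (cs n).
elim: n => // n [cn sn]; have t'n := (smoothP _).1 (smooth_derive st) n; split.
- apply: (@derivable_uptoS _ _ _
    (fun y => -1 * sin (theta y) * derive_within I theta y)).
    move=> x Ix; rewrite mulN1r.
    exact: has_derivative_within_comp (smooth_derivative st Ix).
  apply: derivable_uptoM t'n; apply: derivable_uptoM sn.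
  exact: derivable_upto_cst.
- apply: (@derivable_uptoS _ _ _
    (fun y => cos (theta y) * derive_within I theta y)).
    move=> x Ix; exact: has_derivative_within_comp (smooth_derivative st Ix).
  exact: derivable_uptoM.
Qed.

(** The inverse square root q of f satisfies q' = - (1/2) q^3 f', so n
    derivatives of q and of f' give n derivatives of q'. *)
Lemma smooth_invsqrt (f : R -> R) : (forall x, I x -> 0 < f x) ->
  smooth I f -> smooth I (fun y => (Num.sqrt (f y))^-1 : R).
Proof.
move=> f0 sf; set q := fun y => _ : R.
apply/smoothP => n; elim: n => // n qn.
have f'n := (smoothP _).1 (smooth_derive sf) n.
apply: (@derivable_uptoS _ _ _
  (fun y => - 2^-1 * (q y * (q y * q y)) * derive_within I f y)).
  move=> x Ix; have fx := f0 x Ix.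
  have sfx : Num.sqrt (f x) != 0 by rewrite gt_eqF // sqrtr_gt0.
  have := has_derivative_within_comp (is_deriveV sfx (is_derive1_sqrt fx))
    (smooth_derivative sf Ix).
  rewrite (_ : _ *: _ = - 2^-1 * (q x * (q x * q x))) //.
  rewrite -[LHS]/(- Num.sqrt (f x) ^- 2 * (2 * Num.sqrt (f x))^-1) /q.
  by field.
apply: derivable_uptoM f'n; apply: derivable_uptoM.
  exact: derivable_upto_cst.
exact/(derivable_uptoM qn)/derivable_uptoM.
Qed.

Lemma smooth_coord n (u : R -> 'rV[R]_n) i :
  smooth I u -> smooth I (fun y => u y 0 i : R).
Proof.
move=> su; apply/smoothP => m; elim: m u su => // m IH u su.
apply: (@derivable_uptoS _ _ _ (fun y => derive_within I u y 0 i : R)).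
  by move=> x Ix; exact/has_derivative_within_coord/smooth_derivative.
exact/IH/smooth_derive.
Qed.

Lemma smooth_rV n (u : R -> 'rV[R]_n) :
  (forall i, smooth I (fun y => u y 0 i : R)) -> smooth I u.
Proof.
move=> su; pose e i : 'rV[R]_n := 'e_i.
have := smooth_sum (r := index_enum 'I_n)
  (fun i => smoothZ (su i) (@smooth_cst _ (e i))).
by apply: smooth_ext => y _; rewrite [RHS]row_sum_delta.
Qed.

(** * Vector-valued curves *)

Lemma has_derivative_withinM (a b : R -> R) x (a' b' : R) :
  has_derivative_within a x a' -> has_derivative_within b x b' ->
  has_derivative_within (fun y => a y * b y : R) x (a' * b x + a x * b').
Proof. by move=> aa' bb'; exact: (has_derivative_withinZ aa' bb'). Qed.

Lemma has_derivative_within_dotmul (u v : R -> 'rV[R]_3) x (u' v' : 'rV[R]_3) :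
  has_derivative_within u x u' -> has_derivative_within v x v' ->
  has_derivative_within (fun y => dotmul (u y) (v y)) x
    (dotmul u' (v x) + dotmul (u x) v').
Proof.
move=> uu' vv'; under eq_fun do rewrite dotmulE.
have uvk k := has_derivative_withinM
  (has_derivative_within_coord (i := inord k) uu')
  (has_derivative_within_coord (i := inord k) vv').
pose l k := coord3 k u' * coord3 k (v x) + coord3 k (u x) * coord3 k v'.
have -> : dotmul u' (v x) + dotmul (u x) v' = l 0 + l 1 + l 2.
  by rewrite !dotmulE /l; ring.
exact: has_derivative_withinD (has_derivative_withinD (uvk 0) (uvk 1)) (uvk 2).
Qed.

Lemma smooth_dotmul (u v : R -> 'rV[R]_3) :
  smooth I u -> smooth I v -> smooth I (fun y => dotmul (u y) (v y)).
Proof.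
move=> su sv; under eq_fun do rewrite dotmulE.
have suv k : smooth I (fun y => coord3 k (u y) * coord3 k (v y) : R).
  by apply: smoothM; exact: smooth_coord.
exact: smoothD (smoothD (suv 0%N) (suv 1%N)) (suv 2%N).
Qed.

Lemma smooth_crossmul (u v : R -> 'rV[R]_3) :
  smooth I u -> smooth I v -> smooth I (fun y => crossmul (u y) (v y)).
Proof.
move=> su sv.
have suv k l : smooth I (fun y => u y 0 (inord k) * v y 0 (inord l) : R).
  by apply: smoothM; exact: smooth_coord.
apply: smooth_rV => -[[|[|[|//]]] ltk3]; under eq_fun do rewrite mxE /=;
  exact: smoothB.
Qed.

Lemma dotmul_cst_derive (u v : R -> 'rV[R]_3) c :
  smooth I u -> smooth I v -> (forall y, I y -> dotmul (u y) (v y) = c) ->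
  forall x, I x ->
    dotmul (derive_within I u x) (v x) = - dotmul (u x) (derive_within I v x).
Proof.
move=> su sv uvc x Ix; apply/eqP; rewrite -addr_eq0; apply/eqP.
have := has_derivative_within_dotmul (smooth_derivative su Ix)
  (smooth_derivative sv Ix).
move=> /(has_derivative_within_ext Ix uvc)/(has_derivative_within_unique Ix) <-.
exact/(has_derivative_within_unique Ix)/has_derivative_within_cst.
Qed.

Lemma dotmul_unit_derive (u : R -> 'rV[R]_3) :
  smooth I u -> (forall y, I y -> sphere2 (u y)) ->
  forall x, I x -> dotmul (derive_within I u x) (u x) = 0.
Proof.
move=> su u1 x Ix; have /eqP := dotmul_cst_derive su su u1 Ix.
by rewrite (dotmulC (u x)) -addr_eq0 -mulr2n mulrn_eq0 => /eqP.
Qed.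

(** * Frames along a curve *)

(** What the frames of all orders have in common. *)
Definition moving_frame (t d t1 : R -> 'rV[R]_3) : Prop :=
  legendre_curve I t d /\ forall s, I s -> t1 s = crossmul (t s) (d s).

Lemma moving_frame_smooth_third (t d t1 : R -> 'rV[R]_3) :
  moving_frame t d t1 -> smooth I t1.
Proof.
move=> [[st sd _ _] t1E]; apply: smooth_ext (smooth_crossmul st sd) => s Is.
by rewrite t1E.
Qed.

(** Rotating (d, t1) by theta gives (tm, dm). The derivative of tm has component
    tau - theta' along dm, where tau is the torsion: the angle equation says
    exactly that it vanishes. The normal tm x dm is d x t1 = t. *)
Lemma moving_frame_pred (t d t1 : R -> 'rV[R]_3) (theta : R -> R)
    (tm dm : R -> 'rV[R]_3) :
  moving_frame t d t1 -> smooth I theta ->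
  (forall s, I s -> derive_within I theta s = torsion I d t1 s) ->
  (forall s, I s -> tm s = cos (theta s) *: d s - sin (theta s) *: t1 s) ->
  (forall s, I s -> dm s = sin (theta s) *: d s + cos (theta s) *: t1 s) ->
  moving_frame tm dm t.
Proof.
move=> frm stheta theta' tmE dmE; have st1 := moving_frame_smooth_third frm.
case: frm => -[st sd tdD t'd] t1E; have [scos ssin] := smooth_cos_sin stheta.
have cs2 s : cos (theta s) ^+ 2 = 1 - sin (theta s) ^+ 2 :> R.
  by rewrite cos2sin2.
have orth s : I s -> [/\ dotmul (d s) (d s) = 1, dotmul (d s) (t1 s) = 0 &
    dotmul (t1 s) (t1 s) = 1].
  move=> Is; have [_ t1d t1t1] := dotmul_frame (tdD s Is).
  case: (tdD s Is) => _ dd _; rewrite t1E //.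
  by rewrite [dotmul (d s) (crossmul _ _)]dotmulC.
split; last first.
  move=> s Is; have [_ _ dt1] := crossmul_frame (tdD s Is).
  by rewrite tmE // dmE // crossmul_rotate t1E // dt1 cos2Dsin2 scale1r.
split.
- apply: smooth_ext (smoothB (smoothZ scos sd) (smoothZ ssin st1)) => s Is.
  by rewrite tmE.
- apply: smooth_ext (smoothD (smoothZ ssin sd) (smoothZ scos st1)) => s Is.
  by rewrite dmE.
- move=> s Is; have [dd dt1 t1t1] := orth s Is.
  rewrite /Delta /sphere2 /= tmE // dmE // -scaleNr.
  rewrite !(dotmulDl, dotmulDr, dotmulZl, dotmulZr).
  rewrite (dotmulC (t1 s) (d s)) dd dt1 t1t1.
  by split; have := cs2 s => h; ring: h.
move=> s Is; have [dd dt1 t1t1] := orth s Is.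
have dcos := has_derivative_within_comp (is_derive_cos (theta s))
  (smooth_derivative stheta Is).
have dsin := has_derivative_within_comp (is_derive_sin (theta s))
  (smooth_derivative stheta Is).
have := has_derivative_withinD
  (has_derivative_withinZ dcos (smooth_derivative sd Is))
  (has_derivative_withinZ (has_derivative_withinN dsin)
    (smooth_derivative st1 Is)).
set l := (X in has_derivative_within _ s X) => tml.
have -> : derive_within I tm s = l.
  apply: (has_derivative_within_unique Is).
  apply: (has_derivative_within_ext Is) tml => y Iy.
  by rewrite tmE // scaleNr.
have t1'd : dotmul (derive_within I t1 s) (d s) = - torsion I d t1 s.
  rewrite (@dotmul_cst_derive _ _ 0) // => [|y Iy]; first by rewrite dotmulC.
  by have [_ + _] := orth y Iy; rewrite dotmulC.
have d'd : dotmul (derive_within I d s) (d s) = 0.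
  by apply: dotmul_unit_derive => // y /tdD[].
have t1't1 : dotmul (derive_within I t1 s) (t1 s) = 0.
  by apply: dotmul_unit_derive => // y /orth[].
rewrite /l dmE // !(dotmulDl, dotmulDr, dotmulZl, dotmulZr).
rewrite (dotmulC (t1 s) (d s)) dd dt1 t1t1 t1'd d'd t1't1 theta' //.
rewrite -/(torsion I d t1 s).
have h := cs2 s; ring: h.
Qed.

Lemma frenet_frame_moving (gamma : R -> 'rV[R]_3) k (t d t1 : R -> 'rV[R]_3) :
  frenet_frame I gamma k t d t1 -> moving_frame t d t1.
Proof.
elim=> {k t d t1} [t d t1 _ td t1E|k t d t1 d1 t2 _ _ _ td1 t2E|]; first by [].
  by [].
move=> k t d t1 theta tm dm _ _ IH stheta theta' tmE dmE.
exact: moving_frame_pred IH stheta theta' tmE dmE.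
Qed.

End CalculusOnInterval.

(** * The next frame *)

Unset Implicit Arguments.

Theorem theorem4p5 (R : realType) (I : set R) (gamma : R -> 'rV[R]_3)
    (k : int) (t d t1 : R -> 'rV[R]_3) :
  nontrivial_interval I ->
  smooth I gamma ->
  admits_generalized_frenet_frame I gamma ->
  frenet_frame I gamma k t d t1 ->
  let kappa := curvature I t t1 in
  let tau := torsion I d t1 in
  (forall s, I s -> (kappa s, tau s) <> (0, 0)) ->
  let d1 := fun s : R =>
    (Num.sqrt (kappa s ^+ 2 + tau s ^+ 2))^-1 *:
      (- tau s *: t s + kappa s *: d s) in
  let t2 := fun s : R => crossmul (t1 s) (d1 s) in
  let kappa1 := curvature I t1 t2 in
  let tau1 := torsion I d1 t2 in
  legendre_curve I t1 d1 /\
  (forall s, I s ->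
     kappa1 s = Num.sqrt (kappa s ^+ 2 + tau s ^+ 2) /\
     tau1 s = (kappa s * derive_within I tau s - derive_within I kappa s * tau s)
              / (kappa s ^+ 2 + tau s ^+ 2)).
Proof.
move=> hI _ _ /(frenet_frame_moving hI) frm kappa tau nz d1 t2 kappa1 tau1.
have st1 := moving_frame_smooth_third hI frm; case: frm => -[st sd tdD t'd] t1E.
pose r s := kappa s ^+ 2 + tau s ^+ 2; pose q s := (Num.sqrt (r s))^-1.
pose w s := - tau s *: t s + kappa s *: d s.
have sk : smooth I kappa by exact: (smooth_dotmul hI (smooth_derive st) st1).
have stau : smooth I tau by exact: (smooth_dotmul hI (smooth_derive sd) st1).
have r0 s : I s -> 0 < r s.
  move=> Is; rewrite lt_def addr_ge0 ?sqr_ge0 // andbT paddr_eq0 ?sqr_ge0 //.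
  rewrite !sqrf_eq0; apply/negP => /andP[/eqP k0 /eqP tau0].
  by apply: (nz s Is); rewrite k0 tau0.
have q2 s : I s -> q s ^+ 2 = (r s)^-1.
  by move=> Is; rewrite exprVn sqr_sqrtr // ltW // r0.
have sq : smooth I q.
  apply: (smooth_invsqrt hI r0).
  exact: (smoothD hI (smoothM hI sk sk) (smoothM hI stau stau)).
have sw : smooth I w.
  exact: (smoothD hI (smoothZ hI (smoothN hI stau) st) (smoothZ hI sk sd)).
have sd1 : smooth I d1 by exact: (smoothZ hI sq sw).
have td s : I s -> [/\ dotmul (t s) (t s) = 1, dotmul (d s) (d s) = 1,
    dotmul (t s) (d s) = 0 & dotmul (d s) (t s) = 0].
  by move=> /tdD[/= tt dd td0]; split => //; rewrite dotmulC.
have t1td s : I s -> [/\ dotmul (t1 s) (t s) = 0, dotmul (t1 s) (d s) = 0 &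
    dotmul (t1 s) (t1 s) = 1].
  by move=> Is; rewrite t1E //; exact/dotmul_frame/tdD.
have t1't s : I s -> dotmul (derive_within I t1 s) (t s) = - kappa s.
  move=> Is; rewrite (@dotmul_cst_derive _ _ hI _ _ 0) //.
    by rewrite dotmulC.
  by move=> y /t1td[].
have t1'd s : I s -> dotmul (derive_within I t1 s) (d s) = - tau s.
  move=> Is; rewrite (@dotmul_cst_derive _ _ hI _ _ 0) //.
    by rewrite dotmulC.
  by move=> y /t1td[].
have t2E s : I s -> t2 s = - q s *: (kappa s *: t s + tau s *: d s).
  move=> Is; have [t1t t1d _] := crossmul_frame (tdD s Is).
  rewrite /t2 /d1 crossmulZr crossmulDr !crossmulZr t1E // t1t t1d.
  rewrite -/(r s) -/(q s) [RHS]scaleNr -[RHS]scalerN opprD addrC.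
  by rewrite scaleNr scalerN.
split; first split => //.
- move=> s Is; have [tt dd td0 dt0] := td s Is.
  have [t1t t1d t1t1] := t1td s Is.
  split; rewrite /sphere2 /= ?t1t1 //.
    rewrite !(dotmulZl, dotmulZr, dotmulDl, dotmulDr) tt dd td0 dt0.
    have := q2 s Is; rewrite /q => h; rewrite !mulrA -expr2 h.
    by have := r0 s Is => /lt0r_neq0; rewrite /r => ?; field.
  by rewrite !(dotmulZr, dotmulDr) t1t t1d; ring.
- move=> s Is; rewrite !(dotmulZr, dotmulDr) t1't // t1'd //; ring.
move=> s Is; split.
  rewrite /kappa1 /curvature t2E // !(dotmulZr, dotmulDr) t1't // t1'd //.
  rewrite -/(r s) -[LHS]/(- q s * _).
  rewrite (_ : _ * _ = q s * r s); last by rewrite /r; ring.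
  rewrite -[in X in _ * X](@sqr_sqrtr _ (r s)) ?ltW ?r0 // expr2 mulKf //.
  by rewrite gt_eqF // sqrtr_gt0 r0.
have [tt dd td0 dt0] := td s Is.
have t't : dotmul (derive_within I t s) (t s) = 0.
  by apply: (dotmul_unit_derive hI) => // y /tdD[].
have d'd : dotmul (derive_within I d s) (d s) = 0.
  by apply: (dotmul_unit_derive hI) => // y /tdD[].
have d't : dotmul (derive_within I d s) (t s) = 0.
  rewrite (@dotmul_cst_derive _ _ hI _ _ 0) // => [|y /td[]//].
  by rewrite dotmulC t'd ?oppr0.
have dtau := has_derivative_withinZ
  (has_derivative_withinN (smooth_derivative stau Is))
  (smooth_derivative st Is).
have dw := has_derivative_withinD dtau (has_derivative_withinZ
  (smooth_derivative sk Is) (smooth_derivative sd Is)).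
have := has_derivative_withinZ (smooth_derivative sq Is) dw.
set l := (X in has_derivative_within _ _ s X) => d1l.
have d1'E : derive_within I d1 s = l.
  apply: (has_derivative_within_unique hI Is).
  exact: d1l.
rewrite /tau1 /torsion d1'E t2E // /l.
rewrite -/(r s) -(q2 s Is) mulrC.
exact: dotmul_normalized_derivative (tdD s Is) t't (t'd s Is) d't d'd.
Qed.
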